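(* Let $n\ge 2$ and let $X=(X_{ij})$ be an $n\times n$ adjacency matrix (binary, symmetric, zero diagonal), with $X_{i+}=\sum_{k=1}^n X_{ik}$ and $X_{++}=\sum_{i=1}^n X_{i+}$, and let $\varepsilon_0$ be a real number such that $1\le X_{i+}^2\le\varepsilon_0 X_{++}$ for all $i$. Let $\varepsilon=\{\varepsilon_{ij}:i\ne j\}$ be a family of smooth functions satisfying the sub-exponential assumption with constant $C_0$ (see context), and let $p_{ij}(\alpha)$, $\alpha\in\mathbb{R}^n$, be given by $\log p_{ij}(\alpha)=\alpha_i+\alpha_j+\varepsilon_{ij}(\alpha_i,\alpha_j)$. Put $\tilde\alpha_i=\log X_{i+}-\log\sqrt{X_{++}}$, $\tilde p_{ij}=X_{i+}X_{j+}/X_{++}$, $\bar\varepsilon_0=\{15(C_0+1)\}^{-2}$ and $C=10(C_0+1)$. Suppose $\varepsilon_0\le\bar\varepsilon_0$, let $\hat\alpha$ be a solution to the likelihood equation $\nabla\ell(\hat\alpha)=0$ with $\|\hat\alpha-\tilde\alpha\|_\infty\le C\varepsilon_0$, and let $\hat p_{ij}=p_{ij}(\hat\alpha)$. Define $$\hat\ell=\sum_{i<j}\bigl[X_{ij}\log\hat p_{ij}+(1-X_{ij})\log(1-\hat p_{ij})\bigr],\qquad \tilde\ell=\sum_{i<j}\bigl[X_{ij}\log\tilde p_{ij}+(1-X_{ij})\log(1-\tilde p_{ij})\bigr].$$ Then $$\left|\frac{\hat\ell-\tilde\ell}{\tilde\ell}\right|\le C_2\,\varepsilon_0,\qquad 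C_2=49(C_0+1).$$
   Context: The matrix $X$ is deterministic here. For each pair $i\neq j$, $\varepsilon_{ij}:\mathbb{R}^2\to\mathbb{R}$ is smooth, with $\varepsilon_{ij}(x,y)=\varepsilon_{ji}(y,x)$; it is evaluated at $(\alpha_i,\alpha_j)$. Sub-exponential assumption with constant $C_0\ge 0$: for all pairs $i\ne j$ and all indices $k,l,m$, the functions $\varepsilon_{ij}$, $\partial\varepsilon_{ij}/\partial\alpha_k$, $\partial^2\varepsilon_{ij}/(\partial\alpha_k\partial\alpha_l)$ and $\partial^3\varepsilon_{ij}/(\partial\alpha_k\partial\alpha_l\partial\alpha_m)$ are bounded in absolute value by $C_0\exp(\alpha_i+\alpha_j)$. The log-likelihood of the model with independent Bernoulli edges of probabilities $p_{ij}(\alpha)$, defined where all $p_{ij}(\alpha)<1$, is $$\ell(\alpha)=\sum_{i<j}\bigl[X_{ij}\log p_{ij}(\alpha)+(1-X_{ij})\log(1-p_{ij}(\alpha))\bigr],$$ and the likelihood equation is $\nabla\ell(\alpha)=0$; thus $\hat\ell=\ell(\hat\alpha)$. $\|\cdot\|_\infty$ is the maximum norm on $\mathbb{R}^n$. Under the stated hypotheses, a solution $\hat\alpha$ of the likelihood equation with $\|\hat\alpha-\tilde\alpha\|_\infty\le C\varepsilon_0$ is known to exist; $\hat\alpha$ denotes such a solution. *)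

(* Defs.v *)
(* R^n is 'rV[R]_n, whose library norm `| _ | is the maximum norm. *)
From HB Require Import structures.
From mathcomp Require Import all_boot all_order all_algebra.
From mathcomp Require Import all_classical all_reals all_analysis.

Set Implicit Arguments.
Unset Strict Implicit.
Unset Printing Implicit Defensive.

Import Order.TTheory GRing.Theory Num.Theory.
Import numFieldNormedType.Exports.

Local Open Scope ring_scope.

Section Calculus.
Context {R : realType} {n : nat}.
Implicit Types (f : 'rV[R]_n -> R) (k : 'I_n).

Definition partial k f : 'rV[R]_n -> R := fun a => 'D_(delta_mx 0 k) f a.

Definition iter_partial (s : seq 'I_n) f : 'rV[R]_n -> R := foldr partial f s.

(* C^infinity on the whole of R^n: all iterated partial derivatives, of every
   order and in every order of the variables, exist and are continuous. *)
Definition smooth f :=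
  forall s : seq 'I_n,
    continuous (iter_partial s f) /\
    forall (k : 'I_n) (a : 'rV[R]_n),
      derivable (iter_partial s f) a (delta_mx 0 k).

End Calculus.

Definition smooth2 (R : realType) (f : R -> R -> R) :=
  smooth (fun v : 'rV[R]_2 => f (v 0 0) (v 0 1)).

Section Model.
Context {R : realType} {n : nat}.
Implicit Types (X : 'M[R]_n) (eps : 'I_n -> 'I_n -> R -> R -> R)
  (a : 'rV[R]_n) (P : 'I_n -> 'I_n -> R).

Definition adjacency X :=
  [/\ forall i j, X i j = 0 \/ X i j = 1,
      forall i j, X i j = X j i
    & forall i, X i i = 0].

Definition node_degree X (i : 'I_n) : R := \sum_(k < n) X i k.

Definition degree_sum X : R := \sum_(i < n) node_degree X i.

(* The functions eps i i are never constrained nor used. *)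
Definition eps_family eps :=
  forall i j : 'I_n, i != j ->
    smooth2 (eps i j) /\ forall x y : R, eps i j x y = eps j i y x.

Definition eps_at eps (i j : 'I_n) : 'rV[R]_n -> R :=
  fun a => eps i j (a 0 i) (a 0 j).

Definition sub_exponential (C0 : R) eps :=
  forall (i j : 'I_n), i != j -> forall a : 'rV[R]_n,
    let b := C0 * expR (a 0 i + a 0 j) in
    [/\ `|eps_at eps i j a| <= b,
        forall k, `|partial k (eps_at eps i j) a| <= b,
        forall k l, `|partial k (partial l (eps_at eps i j)) a| <= b
      & forall k l m,
          `|partial k (partial l (partial m (eps_at eps i j))) a| <= b].

Definition edge_prob eps a (i j : 'I_n) : R :=
  expR (a 0 i + a 0 j + eps_at eps i j a).

Definition loglik X P : R :=
  \sum_(i < n) \sum_(j < n | (i < j)%N)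
     (X i j * ln (P i j) + (1 - X i j) * ln (1 - P i j)).

(* The library's ln is 0 on nonpositive reals, so the domain of the
   log-likelihood has to be required explicitly. *)
Definition likelihood_solution X eps a :=
  (forall i j : 'I_n, i != j -> edge_prob eps a i j < 1) /\
  forall k : 'I_n,
    is_derive a (delta_mx 0 k) (fun b => loglik X (edge_prob eps b)) 0.

Definition alpha_tilde X : 'rV[R]_n :=
  \row_i (ln (node_degree X i) - ln (Num.sqrt (degree_sum X))).

Definition p_tilde X (i j : 'I_n) : R := node_degree X i * node_degree X j / degree_sum X.

End Model.

(* Main.v *)
Require Import Defs.
From mathcomp Require Import all_boot all_order all_algebra.
From mathcomp Require Import all_classical all_reals all_analysis.
From mathcomp Require Import ring lra.
Import Order.TTheory GRing.Theory Num.Theory.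
Import numFieldNormedType.Exports.
Local Open Scope ring_scope.

(** The two log-likelihoods are compared edge by edge. Write c = C0 + 1,
    t = c * eps0, p = p_tilde i j, q = edge_prob eps alpha_hat i j, and
    d_i, D for the degrees and their sum. Since ln p is the sum of the
    coordinates i and j of alpha_tilde,
      q = p * exp (u + r),  u = Delta_i + Delta_j,  r = eps_ij (alpha_hat),
    where Delta = alpha_hat - alpha_tilde, so |u| <= 20 t, and
    sub-exponentiality gives |r| <= C0 p exp u. As d_i ^ 2 <= eps0 D for
    every i, p = d_i d_j / D <= eps0, so r is of the same order t as u
    ([perturbed_prob_bounds]). Hence an edge that is present changes the
    log-likelihood by |u + r| <= 22 t, and an absent one by about
    |q - p| <= 25 t p ([edge_loglik_dist]).

    Absent edges are far more numerous than present ones, but their changes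
    carry the factor p, and p has the same sum over all ordered pairs as X,
    namely D. Both matrices are symmetric and X has zero diagonal, so the sum
    of p over i < j is at most the number E of edges ([sum_sym_offdiag]);
    thus |l_hat - l_tilde| <= (22 + 26) t E.

    Finally all terms of l_tilde are nonpositive and a present edge
    contributes ln p <= p - 1 <= - 224/225, so |l_tilde| >= 224/225 E
    ([edge_loglik_ge]), and 48 * 225/224 < 49. *)

Lemma expR_le_inv1B (R : realType) (x : R) : x < 1 -> expR x <= (1 - x)^-1.
Proof.
move=> x1; rewrite -[x in expR x]opprK expRN lef_pV2 ?posrE ?expR_gt0 ?subr_gt0 //.
exact: expR_ge1Dx.
Qed.

(** The worst case is a positive exponent: by the tangent inequality,
    1 - exp (- y) <= y <= exp y - 1 for y >= 0. *)
Lemma dist_expR1_le (R : realType) (x : R) :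
  `|x| < 1 -> `|expR x - 1| <= `|x| / (1 - `|x|).
Proof.
move=> x1.
have up : expR `|x| - 1 <= `|x| / (1 - `|x|).
  have -> : `|x| / (1 - `|x|) = (1 - `|x|)^-1 - 1 by field; rewrite gt_eqF //; lra.
  by rewrite lerD2r expR_le_inv1B.
apply: le_trans up; have [x0|x0] := leP 0 x.
  by have ex := expR_ge1Dx x; rewrite (ger0_norm x0) ger0_norm; lra.
have := expR_ge1Dx x; have := expR_ge1Dx (- x).
have : expR x <= expR (- x) by rewrite ler_expR; lra.
by rewrite (ltr0_norm x0) ler_norml; lra.
Qed.

Lemma ln_onem_sub_le (R : realType) (p q m : R) :
  p <= m -> m < 1 -> q < 1 -> ln (1 - q) - ln (1 - p) <= `|q - p| / (1 - m).
Proof.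
move=> pm m1 q1.
have p0 : 0 < 1 - p by lra.
have q0 : 0 < 1 - q by lra.
rewrite -ln_div ?posrE //.
have -> : (1 - q) / (1 - p) = 1 + (p - q) / (1 - p) by field; rewrite gt_eqF //; lra.
apply: le_trans (le_ln1Dx _) _.
  by rewrite ltr_pdivlMr //; lra.
apply: le_trans (_ : `|q - p| / (1 - p) <= _).
  by rewrite ler_pM2r ?invr_gt0 // distrC ler_norm.
by rewrite ler_wpM2l // lef_pV2 ?posrE //; lra.
Qed.

Lemma dist_ln_onem_le (R : realType) (p q m : R) :
  p <= m -> q <= m -> m < 1 ->
  `|ln (1 - q) - ln (1 - p)| <= `|q - p| / (1 - m).
Proof.
move=> pm qm m1; rewrite ler_norml lerNl opprB; apply/andP; split.
  by rewrite distrC; apply: ln_onem_sub_le => //; lra.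
by apply: ln_onem_sub_le => //; lra.
Qed.

(** The edge probability with all constants made numerical: p is the
    approximate probability, u the error of the two parameters and r the value
    of the perturbation function. The bound t <= 1/225 gives exp u <= 11/10,
    hence |r| <= 11/10 t because C0 p <= C0 e <= t; the resulting exponent
    u + r is below 1/10 in absolute value, where
    exp (u + r) - 1 is at most 10/9 of |u + r| in absolute value. *)
Lemma perturbed_prob_bounds (R : realType) (C0 e p u r : R) :
  let t := (C0 + 1) * e in let q := p * expR (u + r) in
  0 <= C0 -> 0 < p -> p <= e -> t <= 1 / 225 ->
  `|u| <= 20 * t -> `|r| <= C0 * (p * expR u) ->
  [/\ `|u + r| <= 22 * t, `|q - p| <= 25 * t * p & q <= 1 / 200].
Proof.
move=> t q C0ge0 p0 pe tle ule rle.
have C0e : 0 <= C0 * e by rewrite mulr_ge0 //; lra.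
have tE : t = C0 * e + e by rewrite /t; ring.
clearbody t.
have eu : expR u <= 11 / 10.
  apply: le_trans (_ : expR (20 / 225) <= _).
    by rewrite ler_expR; have := ler_norm u; lra.
  apply: le_trans (expR_le_inv1B _ _ _) _; first by lra.
  by rewrite -[leLHS]div1r ler_pdivrMr; lra.
have rt : `|r| <= 11 / 10 * t.
  apply: le_trans rle _; apply: le_trans (_ : C0 * (e * (11 / 10)) <= _).
    by rewrite ler_wpM2l // ler_pM ?expR_ge0 //; lra.
  by lra.
have Lt : `|u + r| <= 22 * t by have := ler_normD u r; lra.
have dq : `|q - p| <= 25 * t * p.
  have -> : q - p = (expR (u + r) - 1) * p by rewrite /q; ring.
  rewrite normrM (gtr0_norm p0) ler_pM2r //.
  apply: le_trans (dist_expR1_le _ _ _) _; first by lra.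
  rewrite ler_pdivrMr; last by lra.
  (* the product needed to pass from 22 t to 25 t (1 - |u + r|) *)
  have : 0 <= t * (1 / 10 - `|u + r|) by rewrite mulr_ge0; lra.
  lra.
split=> //; have := ler_norm (q - p).
have : 0 <= (1 / 225 - t) * p by rewrite mulr_ge0; lra.
lra.
Qed.

(** For a present edge the change is exactly the exponent u + r; for an absent
    one it is |q - p|, inflated by at most 200/199 by the logarithm, which
    turns 25 into 26. *)
Lemma edge_loglik_dist (R : realType) (C0 e p u r x : R) :
  let t := (C0 + 1) * e in let q := p * expR (u + r) in
  0 <= C0 -> 0 < p -> p <= e -> t <= 1 / 225 ->
  `|u| <= 20 * t -> `|r| <= C0 * (p * expR u) -> x = 0 \/ x = 1 ->
  `|(x * ln q + (1 - x) * ln (1 - q)) - (x * ln p + (1 - x) * ln (1 - p))|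
    <= t * (22 * x + 26 * p).
Proof.
move=> t q C0ge0 p0 pe tle ule rle x01.
have C0e : 0 <= C0 * e by rewrite mulr_ge0 //; lra.
have tE : t = C0 * e + e by rewrite /t; ring.
have [Lt dq q200] := perturbed_prob_bounds _ _ _ _ _ _ C0ge0 p0 pe tle ule rle.
rewrite -/t -/q in Lt dq q200.
clearbody t.
have tp : 0 <= t * p by rewrite mulr_ge0; lra.
case: x01 => ->.
  rewrite !mul0r !add0r subr0 !mul1r.
  apply: le_trans (dist_ln_onem_le _ p q (1 / 200) _ _ _) _; try lra.
  by rewrite ler_pdivrMr; lra.
rewrite subrr !mul0r !addr0 !mul1r.
rewrite {1}/q lnM ?posrE ?expR_gt0 // expRK.
have -> : ln p + (u + r) - ln p = u + r by ring.
lra.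
Qed.

(** The crude tangent bound ln p <= p - 1 suffices: it only costs the factor
    225/224 in the final constant. *)
Lemma edge_loglik_ge (R : realType) (p x : R) :
  0 < p -> p <= 1 / 225 -> x = 0 \/ x = 1 ->
  224 / 225 * x <= - (x * ln p + (1 - x) * ln (1 - p)).
Proof.
move=> p0 pe [] ->.
  have : ln (1 - p) <= 0 by rewrite ln_le0 //; lra.
  lra.
have : ln (1 + (p - 1)) <= p - 1 by apply: le_ln1Dx; lra.
by rewrite addrCA subrr addr0; lra.
Qed.

Lemma sum_sym_offdiag (V : nmodType) (n : nat) (f : 'I_n -> 'I_n -> V) :
  (forall i j, f i j = f j i) ->
  \sum_(i < n) \sum_(j < n) f i j =
  (\sum_(i < n) \sum_(j < n | (i < j)%N) f i j) *+ 2 + \sum_(i < n) f i i.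
Proof.
move=> fC.
have flip : \sum_(i < n) \sum_(j < n | (j < i)%N) f i j =
            \sum_(i < n) \sum_(j < n | (i < j)%N) f i j.
  rewrite (exchange_big_dep xpredT) //=.
  by apply: eq_bigr => i _; apply: eq_bigr => j _; exact: fC.
rewrite mulr2n -[X in X + _ + _]flip -!big_split /=.
apply: eq_bigr => i _.
rewrite (bigID (fun j : 'I_n => (j < i)%N)) /= -addrA; congr (_ + _).
rewrite (bigD1 i) /= ?ltnn // addrC; congr (_ + _).
by apply: eq_bigl => j; rewrite -leqNgt ltn_neqAle eq_sym andbC.
Qed.

(** The vector alpha_tilde solves the model without perturbation:
    exp (alpha_tilde_i + alpha_tilde_j) = p_tilde i j. Both quantities are
    therefore p_tilde times the exponential of the remaining terms. *)
Lemma edge_prob_tilde (R : realType) (n : nat) (X : 'M[R]_n)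
    (eps : 'I_n -> 'I_n -> R -> R -> R) (a : 'rV[R]_n) (i j : 'I_n) :
  0 < node_degree X i -> 0 < node_degree X j -> 0 < degree_sum X ->
  let u := (a - alpha_tilde X) 0 i + (a - alpha_tilde X) 0 j in
  expR (a 0 i + a 0 j) = p_tilde X i j * expR u /\
  edge_prob eps a i j = p_tilde X i j * expR (u + eps_at eps i j a).
Proof.
move=> di dj D u.
suff E : expR (a 0 i + a 0 j) = p_tilde X i j * expR u.
  by split=> //; rewrite /edge_prob expRD E -mulrA -expRD.
have s0 : 0 < Num.sqrt (degree_sum X) by rewrite sqrtr_gt0.
have -> : a 0 i + a 0 j = alpha_tilde X 0 i + alpha_tilde X 0 j + u.
  by rewrite /u !mxE; ring.
rewrite expRD; congr (_ * _); rewrite /p_tilde -[in RHS](sqr_sqrtr (ltW D)).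
rewrite !mxE expRD !expRB !lnK ?posrE //; field.
by rewrite gt_eqF.
Qed.

Theorem corollary2 (R : realType) (n : nat) (X : 'M[R]_n) (eps0 C0 : R)
    (eps : 'I_n -> 'I_n -> R -> R -> R) (alpha_hat : 'rV[R]_n) :
  (2 <= n)%N ->
  adjacency X ->
  (forall i : 'I_n, 1 <= node_degree X i ^+ 2 /\
                    node_degree X i ^+ 2 <= eps0 * degree_sum X) ->
  0 <= C0 ->
  eps_family eps ->
  sub_exponential C0 eps ->
  eps0 <= (15 * (C0 + 1)) ^- 2 ->
  likelihood_solution X eps alpha_hat ->
  `|alpha_hat - alpha_tilde X| <= 10 * (C0 + 1) * eps0 ->
  let l_hat := loglik X (edge_prob eps alpha_hat) in
  let l_tilde := loglik X (p_tilde X) in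
  `|(l_hat - l_tilde) / l_tilde| <= 49 * (C0 + 1) * eps0.
Proof.
move=> n2 [X01 Xsym Xdiag] deg C0ge0 _ subexp eps0_le _ dist_le.
lazy zeta; set l_hat := loglik X (edge_prob _ _); set l_tilde := loglik X (p_tilde X).
have X_ge0 i j : 0 <= X i j by case: (X01 i j) => ->; lra.
have d_ge0 i : 0 <= node_degree X i by apply: sumr_ge0 => k _.
have d_ge1 i : 1 <= node_degree X i.
  by have [+ _] := deg i; rewrite -[X in X <= _](expr1n R 2) ler_pXn2r ?nnegrE.
have d_gt0 i : 0 < node_degree X i by have := d_ge1 i; lra.
have D_gt0 : 0 < degree_sum X.
  rewrite /degree_sum (bigD1 (Ordinal (ltnW n2))) //=.
  by rewrite ltr_wpDr ?d_gt0 // sumr_ge0.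
have p_gt0 i j : 0 < p_tilde X i j by rewrite divr_gt0 // mulr_gt0.
have p_le i j : p_tilde X i j <= eps0.
  rewrite ler_pdivrMr //.
  (* d_i d_j <= (d_i ^ 2 + d_j ^ 2) / 2 *)
  have [_ di] := deg i; have [_ dj] := deg j.
  have : 0 <= (node_degree X i - node_degree X j) ^+ 2 by exact: sqr_ge0.
  by rewrite sqrrB; lra.
have eps0_gt0 : 0 < eps0.
  have i0 := Ordinal (ltnW n2); exact: lt_le_trans (p_gt0 i0 i0) (p_le i0 i0).
set t := (C0 + 1) * eps0.
have eps0_t : eps0 <= t by rewrite /t ler_peMl; lra.
(* t = c eps0 <= c ^ 2 eps0 <= 1/225, as c >= 1 *)
have t_le : t <= 1 / 225.
  have c2 : (15 * (C0 + 1)) ^+ 2 * eps0 <= 1.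
    by rewrite mulrC -ler_pdivlMr ?mul1r // exprn_gt0; lra.
  have : t <= (C0 + 1) * t by rewrite ler_peMl; lra.
  by rewrite /t; move: c2; rewrite exprMn; lra.
set E := \sum_(i < n) \sum_(j < n | (i < j)%N) X i j.
have E_ge0 : 0 <= E by do 2!apply: sumr_ge0 => ? _.
have sum_p : \sum_(i < n) \sum_(j < n | (i < j)%N) p_tilde X i j <= E.
  have pC i j : p_tilde X i j = p_tilde X j i.
    by rewrite /p_tilde [node_degree X i * _]mulrC.
  have DE : \sum_(i < n) \sum_(j < n) p_tilde X i j = degree_sum X.
    under eq_bigr => i _ do rewrite /p_tilde -mulr_suml -mulr_sumr.
    by rewrite -!mulr_suml mulfK ?gt_eqF.
  have := sum_sym_offdiag _ _ _ pC; rewrite DE.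
  have := sum_sym_offdiag _ _ _ Xsym.
  rewrite -/(degree_sum X) -/E => ->.
  have -> : \sum_(i < n) X i i = 0 by apply: big1 => i _.
  have : 0 <= \sum_(i < n) p_tilde X i i by apply: sumr_ge0 => i _; exact: ltW.
  lra.
have num_le : `|l_hat - l_tilde| <= t * (48 * E).
  apply: le_trans (_ : \sum_(i < n) \sum_(j < n | (i < j)%N)
     t * (22 * X i j + 26 * p_tilde X i j) <= _).
    rewrite -sumrB; apply: le_trans (ler_norm_sum _ _ _) _.
    apply: ler_sum => i _; rewrite -sumrB; apply: le_trans (ler_norm_sum _ _ _) _.
    apply: ler_sum => j ij.
    have [aE pE] := edge_prob_tilde _ _ X eps alpha_hat i j
      (d_gt0 i) (d_gt0 j) D_gt0.
    rewrite pE; apply: edge_loglik_dist => //.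
      have coord k : `|(alpha_hat - alpha_tilde X) 0 k| <= 10 * t.
        apply: le_trans (_ : `|alpha_hat - alpha_tilde X| <= _); last first.
          by rewrite /t mulrA.
        rewrite [leRHS]mx_normrE.
        exact: (le_bigmax _ (fun ij => `|_ ij.1 ij.2|) (0, k)).
      by rewrite -/t; apply: le_trans (ler_normD _ _) _; have := coord i; have := coord j; lra.
    rewrite -aE; have ij' : i != j by apply: contraTneq ij => ->; rewrite ltnn.
    by have [] := subexp i j ij' alpha_hat.
  under eq_bigr => i _ do rewrite -mulr_sumr big_split /= -!mulr_sumr.
  rewrite -mulr_sumr big_split /= -!mulr_sumr -/E ler_wpM2l; lra.
have den_ge : 224 / 225 * E <= `|l_tilde|.
  apply: le_trans (_ : - l_tilde <= _); last by rewrite -normrN ler_norm.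
  rewrite mulr_sumr -sumrN; apply: ler_sum => i _.
  rewrite mulr_sumr -sumrN; apply: ler_sum => j _.
  by apply: edge_loglik_ge => //; have := p_le i j; lra.
(* the degree-two facts behind 48 t E <= 49 t |l_tilde| *)
have tE : 0 <= t * (`|l_tilde| - 224 / 225 * E) by rewrite mulr_ge0; lra.
have tE0 : 0 <= t * E by rewrite mulr_ge0; lra.
rewrite -mulrA -/t normrM normfV.
(* a zero denominator makes the quotient zero *)
have [->|l0] := eqVneq l_tilde 0; first by rewrite normr0 invr0 mulr0; lra.
by rewrite ler_pdivrMr ?normr_gt0 //; lra.
Qed.
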